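(* Let $p>1$, let $\Gamma$ be a connected simple graph with $N\ge 2$ vertices and let $F=\{f_i\}_{i=1}^N$ be an $\mathcal{L}_\Gamma(N,N-1)$-frame for $\mathbb{R}^{N-1}$. If $F$ is a tight frame, then $(F,S_F^{-1}F)\in\mathcal{E}_2^p$.
   Context: A sequence $F=\{f_i\}_{i=1}^N$ in an $n$-dimensional Hilbert space $\mathcal{H}$ is a frame if there are $A,B>0$ with $A\|f\|^2\le\sum_{i=1}^N|\langle f,f_i\rangle|^2\le B\|f\|^2$ for all $f\in\mathcal{H}$; it is tight if one can take $A=B$. Its analysis operator is $\Theta_F f=(\langle f,f_i\rangle)_{i=1}^N$, with adjoint $\Theta_F^*(c_i)_i=\sum_i c_if_i$; the frame operator is $S_F=\Theta_F^*\Theta_F$ (positive and invertible). A frame $G=\{g_i\}_{i=1}^N$ is a dual of $F$ if $f=\sum_{i=1}^N\langle f,f_i\rangle g_i$ for all $f$; then $(F,G)$ is an $(N,n)$ dual pair. The canonical dual is $S_F^{-1}F=\{S_F^{-1}f_i\}_{i=1}^N$. For $1\le k\le N$ let $\mathcal{D}^{(k)}$ be the set of $N\times N$ diagonal matrices with exactly $k$ diagonal entries equal to $1$ and all others $0$. With $\rho$ the spectral radius (largest modulus of a complex eigenvalue), define $\mathcal{E}_k^p(F,G)=\Big\{\frac{1}{\binom{N}{k}}\sum_{D\in\mathcal{D}^{(k)}}\big(\rho(\Theta_G^*D\Theta_F)\big)^p\Big\}^{1/p}$. Let $\delta_1^p=\inf\{\mathcal{E}_1^p(F,G):(F,G)\text{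 an }(N,n)\text{ dual pair}\}$, $\mathcal{E}_1^p=\{(F,G)\ (N,n)\text{ dual pair}:\mathcal{E}_1^p(F,G)=\delta_1^p\}$, $\delta_2^p=\inf\{\mathcal{E}_2^p(F,G):(F,G)\in\mathcal{E}_1^p\}$ and $\mathcal{E}_2^p=\{(F,G)\in\mathcal{E}_1^p:\mathcal{E}_2^p(F,G)=\delta_2^p\}$. (Superscript $p$ is an index, not a power.) Here $\mathcal{H}=\mathbb{R}^{N-1}$, $n=N-1$. For a simple graph $\Gamma$ on vertices $v_1,\dots,v_N$, the Laplacian is $\mathcal{L}(\Gamma)=\mathcal{D}(\Gamma)-\mathcal{A}(\Gamma)$, with $\mathcal{D}(\Gamma)$ the diagonal degree matrix and $\mathcal{A}(\Gamma)$ the adjacency matrix. If $\Gamma$ has $N-n$ connected components, write $\mathcal{L}(\Gamma)=M\,\mathrm{diag}(\lambda_1,\dots,\lambda_n,0,\dots,0)M^*$ with $\lambda_1,\dots,\lambda_n$ the nonzero eigenvalues and $M$ a unitary (here real orthogonal) matrix of corresponding eigenvectors; let $M_1$ consist of the first $n$ columns of $M$ and $B=\mathrm{diag}(\sqrt{\lambda_1},\dots,\sqrt{\lambda_n})M_1^*$. Any frame of the form $\{Be_i\}_{i=1}^N$, with $(e_i)$ the standard basis, is called an $\mathcal{L}_\Gamma(N,n)$-frame; its Gramian matrix $\Theta_F\Theta_F^*$ is $\mathcal{L}(\Gamma)$. *)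

(* Defs.v *)
From HB Require Import structures.
From mathcomp Require Import all_boot all_order all_algebra.
From mathcomp Require Import all_classical all_reals all_analysis.
From mathcomp Require Import complex.

Set Implicit Arguments.
Unset Strict Implicit.
Unset Printing Implicit Defensive.

Import Order.TTheory GRing.Theory Num.Theory.

Local Open Scope classical_set_scope.
Local Open Scope ring_scope.

Section Frames.
Variables (R : realType) (N n : nat).
Implicit Types F G : 'I_N -> 'cV[R]_n.

Definition dotp (u v : 'cV[R]_n) : R := \sum_j u j 0 * v j 0.

Definition frame_bounds F (A B : R) : Prop :=
  [/\ 0 < A, 0 < B &
    forall f, A * dotp f f <= \sum_i `|dotp f (F i)| ^+ 2 <= B * dotp f f].

Definition is_frame F : Prop := exists A B, frame_bounds F A B.

Definition tight_frame F : Prop := exists A, frame_bounds F A A.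

(* Matrix of the analysis operator in the standard bases; the operator itself
   is given by [analysis_mxE], and its adjoint is the transpose. *)
Definition analysis_mx F : 'M[R]_(N, n) := \matrix_(i, j) F i j 0.

Lemma analysis_mxE F (f : 'cV[R]_n) :
  analysis_mx F *m f = \col_i dotp f (F i).
Proof.
by apply/colP => i; rewrite !mxE; apply: eq_bigr => j _; rewrite mxE mulrC.
Qed.

Lemma analysis_mx_adjE F (c : 'cV[R]_N) :
  (analysis_mx F)^T *m c = \sum_i c i 0 *: F i.
Proof.
apply/colP => j; rewrite mxE summxE.
by apply: eq_bigr => i _; rewrite !mxE mulrC.
Qed.

Definition frame_op F : 'M[R]_n := (analysis_mx F)^T *m analysis_mx F.

Definition canonical_dual F : 'I_N -> 'cV[R]_n :=
  fun i => invmx (frame_op F) *m F i.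

Definition dual_pair F G : Prop :=
  [/\ is_frame F, is_frame G &
    forall f : 'cV[R]_n, f = \sum_i dotp f (F i) *: G i].

(* [eigenvalue] uses row eigenvectors, hence is the same set of eigenvalues.
   For [0 < n] this set is nonempty and finite, so [sup] is a maximum. *)
Definition spectral_radius (A : 'M[R]_n) : R :=
  sup [set ComplexField.Normc.normc z
      | z in [set z : R[i] | eigenvalue (map_mx (real_complex R) A) z]].

(* The 0/1 diagonal matrices with exactly [k] ones are the [erasure_mx K]
   with [#|K| = k], each obtained from a unique [K]. *)
Definition erasure_mx (K : {set 'I_N}) : 'M[R]_N :=
  diag_mx (\row_i (i \in K)%:R).

Definition erasure_error (k : nat) (p : R) F G : R :=
  ('C(N, k)%:R^-1 *
   \sum_(K : {set 'I_N} | #|K| == k)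
     spectral_radius ((analysis_mx G)^T *m erasure_mx K *m analysis_mx F) `^ p)
  `^ p^-1.

(* All the errors are nonnegative, so the infima below are those of sets
   bounded from below. *)
Definition delta1 (p : R) : R :=
  inf [set erasure_error 1 p FG.1 FG.2 | FG in [set FG | dual_pair FG.1 FG.2]].

Definition optimal1 (p : R) : set (('I_N -> 'cV[R]_n) * ('I_N -> 'cV[R]_n)) :=
  [set FG | dual_pair FG.1 FG.2 /\ erasure_error 1 p FG.1 FG.2 = delta1 p].

Definition delta2 (p : R) : R :=
  inf [set erasure_error 2 p FG.1 FG.2 | FG in optimal1 p].

Definition optimal2 (p : R) : set (('I_N -> 'cV[R]_n) * ('I_N -> 'cV[R]_n)) :=
  [set FG | optimal1 p FG /\ erasure_error 2 p FG.1 FG.2 = delta2 p].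

End Frames.

Section Graphs.
Variables (R : realType) (N : nat).

Definition simple_graph (e : rel 'I_N) : Prop := symmetric e /\ irreflexive e.

Definition connected_graph (e : rel 'I_N) : Prop := forall x y, connect e x y.

Definition adjacency_mx (e : rel 'I_N) : 'M[R]_N := \matrix_(i, j) (e i j)%:R.

Definition degree_mx (e : rel 'I_N) : 'M[R]_N :=
  diag_mx (\row_i #|[set j | e i j]%SET|%:R).

Definition laplacian (e : rel 'I_N) : 'M[R]_N := degree_mx e - adjacency_mx e.

(* [lam] is the whole diagonal (lambda_1, ..., lambda_n, 0, ..., 0); the matrix
   [colsub (widen_ord leqnN) M] consists of the first [n] columns of [M]. *)
Definition laplacian_frame (e : rel 'I_N) (n : nat) (F : 'I_N -> 'cV[R]_n) :
    Prop :=
  exists (leqnN : (n <= N)%N) (M : 'M[R]_N) (lam : 'rV[R]_N),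
  [/\ n_comp e predT = (N - n)%N,
      M *m M^T = 1%:M,
      forall j : 'I_N, (lam 0 j != 0) = (j < n)%N,
      laplacian e = M *m diag_mx lam *m M^T &
      forall i, F i =
        diag_mx (\row_(k < n) Num.sqrt (lam 0 (widen_ord leqnN k)))
        *m (colsub (widen_ord leqnN) M)^T *m delta_mx i 0].

End Graphs.

(* Main.v *)
Require Import Defs.
From HB Require Import structures.
From mathcomp Require Import all_boot all_order all_algebra.
From mathcomp Require Import all_classical all_reals all_analysis.
From mathcomp Require Import complex.
From mathcomp Require Import ring.

Set Implicit Arguments.
Unset Strict Implicit.
Unset Printing Implicit Defensive.

Import Order.TTheory GRing.Theory Num.Theory.

Local Open Scope classical_set_scope.
Local Open Scope ring_scope.

(** The idea: over dual pairs, both errors have a lower bound that the tight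
    Laplacian frame and its canonical dual attain, so no description of the other
    optimal pairs is needed. Write [n = N - 1], and let [T_K] be the operator
    attached to the erasure set [K], that is the sum of the [G_i F_i^T] for [i] in
    [K]; its spectral radius enters the error.

    One erasure. [T_{i}] has rank one, so its spectral radius is [|<F_i, G_i>|].
    For a dual pair the [<F_i, G_i>] sum to the trace of the identity, which is
    [n], and the power mean inequality gives an error at least [n / N]
    ([erasure_error1_ge]). For the frame at hand all the [<F_i, G_i>] are equal to
    [n / N]: the Gramian of [F] is a multiple of an orthogonal projection, and the
    kernel of that projection is the line of constant vectors because the rows of a
    Laplacian sum to zero ([laplacian_frame_sqnorm]).

    Two erasures. [1 - T_K] is a sum of [N - 2 < n] matrices of rank at most one,
    hence singular: [1] is an eigenvalue of [T_K] for every dual pair, and the error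
    is at least [1] ([spectral_radius_erasure_ge1]). For a tight frame and its
    canonical dual, [T_K] is a compression of the orthogonal projection on the
    coordinates in [K] by an isometry, so its spectral radius is at most [1]
    ([spectral_radius_tight_le1]). *)

(** * Power means *)

(** The graph of the convex function [x `^ p] lies above its tangent at [1]. For
    [x = expR t], this is the sum of the inequality
    [x * expR ((p - 1) * t) >= x * (1 + (p - 1) * t)] and of [p - 1] times
    [x * expR (- t) >= x * (1 - t)]. *)
Lemma powR_ge_tangent1 (R : realType) (p x : R) :
  1 <= p -> 0 <= x -> 1 + p * (x - 1) <= x `^ p.
Proof.
move=> p1; rewrite le_eqVlt => /orP[/eqP <-|x0].
  rewrite sub0r mulrN1 (@le_trans _ _ 0) ?powR_ge0 //.
  by rewrite subr_le0.
rewrite /powR gt_eqF //; set t := ln x.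
have xE : x = expR t by rewrite lnK ?posrE.
have h1 : x * (1 + (p - 1) * t) <= expR (p * t).
  have -> : p * t = t + (p - 1) * t by rewrite mulrBl mul1r addrC subrK.
  by rewrite expRD -xE ler_wpM2l ?expR_ge1Dx // ltW.
have h2 : x * (1 - t) <= 1.
  have {2}-> : 1 = x * expR (- t) :> R by rewrite xE expRxMexpNx_1.
  by rewrite ler_wpM2l ?expR_ge1Dx // ltW.
have h3 : (p - 1) * (x * (1 - t)) <= p - 1.
  by rewrite ler_piMr // subr_ge0.
have := lerD h1 h3; rewrite -lerBlDr; apply: le_trans.
by rewrite le_eqVlt; apply/orP; left; apply/eqP; ring.
Qed.

(** Power mean inequality, for the arithmetic mean and an exponent [p >= 1]. *)
Lemma powR_mean_ge (R : realType) (p : R) (n : nat) (x : 'I_n -> R) :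
  1 <= p -> (0 < n)%N -> (forall i, 0 <= x i) ->
  n%:R^-1 * \sum_i x i <= (n%:R^-1 * \sum_i x i `^ p) `^ p^-1.
Proof.
move=> p1 n0 x0; set m := n%:R^-1 * _.
have p0 : 0 < p by apply: lt_le_trans p1.
have nR : (0 : R) < n%:R by rewrite ltr0n.
have m0 : 0 <= m by rewrite mulr_ge0 ?invr_ge0 ?ler0n ?sumr_ge0.
have [mE|mN0] := eqVneq m 0; first by rewrite mE powR_ge0.
have mpos : 0 < m by rewrite lt_neqAle eq_sym mN0.
suff le_p : m `^ p <= n%:R^-1 * \sum_i x i `^ p.
  have {1}-> : m = (m `^ p) `^ p^-1.
    by rewrite -powRrM mulfV ?gt_eqF // powRr1.
  apply: ge0_ler_powR; rewrite ?nnegrE ?invr_ge0 ?powR_ge0 ?(ltW p0) //.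
  exact: le_trans (powR_ge0 _ _) le_p.
(* Sum of the tangent inequalities at the mean [m]; their linear terms cancel. *)
rewrite -(ler_pM2l nR) mulVKf ?gt_eqF //.
have tan i : m `^ p * (1 + p * (x i / m - 1)) <= x i `^ p.
  have {2}-> : x i = m * (x i / m) by rewrite mulrC divfK.
  rewrite [leRHS]powRM ?divr_ge0 // ler_wpM2l ?powR_ge0 //.
  by rewrite powR_ge_tangent1 ?divr_ge0.
apply: le_trans (ler_sum _ (fun i _ => tan i)).
rewrite -mulr_sumr big_split /= -mulr_sumr sumrB -mulr_suml !sumr_const card_ord.
have -> : \sum_i x i = n%:R * m by rewrite mulVKf ?gt_eqF.
by rewrite mulfK // subrr mulr0 addr0 mulrC.
Qed.

Lemma powR_mean_const (R : realType) (p x : R) (I : finType) (P : pred I)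
    (k : nat) :
  0 < p -> 0 <= x -> #|P| = k -> (0 < k)%N ->
  (k%:R^-1 * \sum_(i | P i) x `^ p) `^ p^-1 = x.
Proof.
move=> p0 x0 Pk k0; rewrite sumr_const Pk -[X in _ * X]mulr_natl mulKf.
  by rewrite -powRrM mulfV ?gt_eqF // powRr1.
by rewrite pnatr_eq0 -lt0n.
Qed.

Lemma powR_mean_le (R : realType) (p c : R) (I : finType) (P : pred I)
    (x y : I -> R) :
  0 < p -> 0 <= c -> (forall i, P i -> 0 <= x i <= y i) ->
  (c * \sum_(i | P i) x i `^ p) `^ p^-1 <= (c * \sum_(i | P i) y i `^ p) `^ p^-1.
Proof.
move=> p0 c0 xy; have mean0 z : 0 <= c * \sum_(i | P i) z i `^ p.
  by rewrite mulr_ge0 // sumr_ge0 // => *; apply: powR_ge0.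
apply: ge0_ler_powR; rewrite ?nnegrE ?invr_ge0 ?(ltW p0) //.
rewrite ler_wpM2l // ler_sum // => i /xy /andP[xi0 xyi].
by apply: ge0_ler_powR; rewrite ?nnegrE ?(ltW p0) // (le_trans xi0).
Qed.

(** * Spectral radius *)

Lemma eigenvalue_moduli_ubound (R : realType) (n : nat) (A : 'M[R[i]]_n) :
  has_ubound [set ComplexField.Normc.normc z | z in [set z | eigenvalue A z]].
Proof.
have [r rE] := closed_field_poly_normal (char_poly A).
exists (\sum_(x <- r) ComplexField.Normc.normc x) => _ [z /= Az <-].
have normc_ge0 (x : R[i]) : 0 <= ComplexField.Normc.normc x.
  by case: x => a b; apply: sqrtr_ge0.
have zr : z \in r.
  move: Az; rewrite eigenvalue_root_char rE rootZ ?root_prod_XsubC //.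
  by rewrite (monicP (char_poly_monic A)) oner_eq0.
by rewrite (big_rem z zr) /= lerDl sumr_ge0.
Qed.

Lemma normc_real (R : realType) (t : R) :
  ComplexField.Normc.normc (real_complex R t) = `|t|.
Proof. by rewrite /ComplexField.Normc.normc /= expr0n addr0 sqrtr_sqr. Qed.

Lemma normr_eigenvalue_le (R : realType) (n : nat) (A : 'M[R]_n) (t : R) :
  eigenvalue A t -> `|t| <= spectral_radius A.
Proof.
move=> At; apply: ub_le_sup; first exact: eigenvalue_moduli_ubound.
by exists (real_complex R t); rewrite ?normc_real //= eigenvalue_map.
Qed.

Lemma spectral_radius_ge0 (R : realType) (n : nat) (A : 'M[R]_n) :
  0 <= spectral_radius A.
Proof.
rewrite /spectral_radius; set S := (X in sup X).
have [->|/set0P[x Sx]] := eqVneq S set0; first by rewrite sup0.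
apply: le_trans (ub_le_sup (eigenvalue_moduli_ubound _) Sx).
by case: Sx => -[a b] _ <-; apply: sqrtr_ge0.
Qed.

(** The hypothesis [0 <= b] covers the case of a matrix of size zero, whose
    spectral radius is the supremum of the empty set, [0]. *)
Lemma spectral_radius_le (R : realType) (n : nat) (A : 'M[R]_n) (b : R) :
  0 <= b ->
  (forall z, eigenvalue (map_mx (real_complex R) A) z ->
     `|z| <= real_complex R b) ->
  spectral_radius A <= b.
Proof.
move=> b0 Ab; rewrite /spectral_radius; set S := (X in sup X).
have [->|/set0P S0] := eqVneq S set0; first by rewrite sup0.
apply: ge_sup => // _ [z /Ab + <-].
by case: z => x y; rewrite normc_def lecR.
Qed.

(** The only nonzero eigenvalue that [g *m f^T] can have is its trace. *)
Lemma spectral_radius_rank1 (R : realType) (n : nat) (f g : 'cV[R]_n) :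
  (0 < n)%N -> spectral_radius (g *m f^T) = `|dotp f g|.
Proof.
move=> n0.
have fg : f^T *m g = (dotp f g)%:M.
  rewrite [LHS]mx11_scalar mxE; congr (_%:M).
  by apply: eq_bigr => j _; rewrite mxE.
apply/eqP; rewrite eq_le; apply/andP; split.
  apply: spectral_radius_le => // z /eigenvalueP[v].
  rewrite map_mxM mulmxA => vz v0.
  have [-> | z0] := eqVneq z 0; first by rewrite normr0 lecR.
  pose c := v *m map_mx (real_complex R) g.
  have c0 : c != 0.
    apply: contraNneq v0 => c0; move: vz; rewrite -/c c0 mul0mx => /esym/eqP.
    by rewrite scaler_eq0 (negPf z0).
  have : c *m map_mx (real_complex R) (f^T *m g) = z *: c.
    by rewrite map_mxM mulmxA vz -scalemxAl.
  rewrite fg map_scalar_mx mul_mx_scalar => /eqP.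
  rewrite -subr_eq0 -scalerBl scaler_eq0 (negPf c0) orbF subr_eq0 => /eqP <-.
  by rewrite normc_def /= expr0n addr0 sqrtr_sqr lexx.
apply: normr_eigenvalue_le; apply/eigenvalueP.
have [f0 | f0] := eqVneq f 0.
  exists (const_mx 1).
    rewrite f0 trmx0 !mulmx0 /dotp big1 ?scale0r // => j _.
    by rewrite mxE mul0r.
  by apply/rV0Pn; exists (Ordinal n0); rewrite mxE oner_eq0.
exists f^T; first by rewrite mulmxA fg mul_scalar_mx.
by apply: contraNneq f0 => f0; rewrite -[f]trmxK f0 trmx0.
Qed.

(** * Erasures of dual pairs *)

Lemma erasure_opE (R : realType) (N n : nat) (F G : 'I_N -> 'cV[R]_n)
    (K : {set 'I_N}) :
  (analysis_mx G)^T *m erasure_mx R K *m analysis_mx F =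
  \sum_(i in K) G i *m (F i)^T.
Proof.
apply/matrixP => j k; rewrite summxE mxE [RHS]big_mkcond.
apply: eq_bigr => i _; rewrite mul_mx_diag !mxE big_ord1 !mxE.
by case: (i \in K); rewrite /= ?mulr1 // mulr0 mul0r.
Qed.

Lemma dual_pair_mx (R : realType) (N n : nat) (F G : 'I_N -> 'cV[R]_n) :
  dual_pair F G -> (analysis_mx G)^T *m analysis_mx F = 1%:M.
Proof.
case=> _ _ FG; apply/matrixP => i j.
transitivity ((delta_mx j 0 : 'cV[R]_n) i 0); last by rewrite !mxE andbT.
rewrite (FG (delta_mx j 0)) summxE mxE; apply: eq_bigr => k _.
rewrite !mxE mulrC; congr (_ * _).
rewrite /dotp (bigD1 j) //= mxE !eqxx mul1r big1 ?addr0 // => l lj.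
by rewrite mxE (negPf lj) mul0r.
Qed.

Lemma dual_pair_sum (R : realType) (N n : nat) (F G : 'I_N -> 'cV[R]_n) :
  dual_pair F G -> \sum_i G i *m (F i)^T = 1%:M.
Proof.
move=> /dual_pair_mx <-; have := erasure_opE F G [set: 'I_N]%SET.
rewrite big_mkcond; under eq_bigr do rewrite finset.in_setT.
move=> <-; congr (_ *m _); rewrite -[RHS]mulmx1; congr (_ *m _).
by apply/matrixP => i j; rewrite !mxE finset.in_setT.
Qed.

(** Trace of the reconstruction formula. *)
Lemma dual_pair_sum_dotp (R : realType) (N n : nat) (F G : 'I_N -> 'cV[R]_n) :
  dual_pair F G -> \sum_i dotp (F i) (G i) = n%:R.
Proof.
move=> /dual_pair_sum /(congr1 mxtrace); rewrite mxtrace1 raddf_sum => <-.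
apply: eq_bigr => i _ /=; apply: eq_bigr => j _.
by rewrite !mxE big_ord1 !mxE mulrC.
Qed.

(** When fewer than [n] vectors remain, some nonzero row vector annihilates the
    operator of the remaining part; it is then a left eigenvector, for the
    eigenvalue [1], of the operator of the erased part. *)
Lemma spectral_radius_erasure_ge1 (R : realType) (N n : nat)
    (F G : 'I_N -> 'cV[R]_n) (K : {set 'I_N}) :
  dual_pair F G -> (N < #|K| + n)%N ->
  1 <= spectral_radius ((analysis_mx G)^T *m erasure_mx R K *m analysis_mx F).
Proof.
move=> /dual_pair_sum FG Kn; rewrite -[leLHS]normr1.
apply: normr_eigenvalue_le; rewrite /eigenvalue kermx_eq0 /row_free.
(* [T_K - 1] is minus the sum of the rank one terms with index outside [K]. *)
rewrite erasure_opE -FG [X in _ - X](bigID (mem K)) /= opprD addNKr mxrank_opp.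
rewrite ltn_eqF // (@leq_ltn_trans #|~: K|) //; last first.
  by rewrite -(ltn_add2l #|K|) cardsC card_ord.
rewrite (eq_bigl [in ~: K]) => [|i]; last by rewrite !inE.
rewrite -sum1_card.
apply: (big_rec2 (fun A m => \rank A <= m)%N) => [|i A m _ IH].
  by rewrite mxrank0.
apply: leq_trans (mxrank_add _ _) _; apply: leq_add => //.
by apply: leq_trans (mxrankM_maxl _ _) _; apply: rank_leq_col.
Qed.

Lemma erasure_error1E (R : realType) (N n : nat) (p : R)
    (F G : 'I_N -> 'cV[R]_n) :
  (0 < n)%N ->
  erasure_error 1 p F G =
  (N%:R^-1 * \sum_i `|dotp (F i) (G i)| `^ p) `^ p^-1.
Proof.
move=> n0; rewrite /erasure_error bin1; congr ((_ * _) `^ _).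
rewrite (eq_bigl [in finset.set1 @: [set: 'I_N]%SET]); last first.
  move=> K; apply/cards1P/imsetP => [[i ->]|[i _ ->]]; last by exists i.
  by exists i.
rewrite big_imset /=; last by move=> i j _ _ /set1_inj.
apply: eq_big => [i|i _]; first by rewrite inE.
by rewrite erasure_opE big_set1 spectral_radius_rank1.
Qed.

Lemma erasure_error1_ge (R : realType) (N n : nat) (p : R)
    (F G : 'I_N -> 'cV[R]_n) :
  1 <= p -> (0 < n)%N -> (0 < N)%N -> dual_pair F G ->
  n%:R / N%:R <= erasure_error 1 p F G.
Proof.
move=> p1 n0 N0 FG; rewrite erasure_error1E // -(dual_pair_sum_dotp FG) mulrC.
apply: le_trans (powR_mean_ge p1 N0 (fun i => normr_ge0 _)).
by rewrite ler_wpM2l ?invr_ge0 ?ler0n // ler_sum // => i _; apply: ler_norm.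
Qed.

Lemma card_erasures (N k : nat) : #|[pred K : {set 'I_N} | #|K| == k]| = 'C(N, k).
Proof. by rewrite -[in RHS](card_ord N) -card_draws cardsE. Qed.

Lemma erasure_error_ge (R : realType) (N n k : nat) (p b : R)
    (F G : 'I_N -> 'cV[R]_n) :
  0 < p -> 0 <= b -> (k <= N)%N ->
  (forall K : {set 'I_N}, #|K| = k ->
    b <= spectral_radius
      ((analysis_mx G)^T *m erasure_mx R K *m analysis_mx F)) ->
  b <= erasure_error k p F G.
Proof.
move=> p0 b0 kN bK; have C0 : (0 < 'C(N, k))%N by rewrite bin_gt0.
rewrite -[leLHS](powR_mean_const p0 b0 (card_erasures N k) C0).
apply: powR_mean_le; rewrite ?invr_ge0 ?ler0n // => K /eqP Kk.
by rewrite b0 bK.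
Qed.

Lemma erasure_error_le (R : realType) (N n k : nat) (p b : R)
    (F G : 'I_N -> 'cV[R]_n) :
  0 < p -> 0 <= b -> (k <= N)%N ->
  (forall K : {set 'I_N}, #|K| = k ->
    spectral_radius
      ((analysis_mx G)^T *m erasure_mx R K *m analysis_mx F) <= b) ->
  erasure_error k p F G <= b.
Proof.
move=> p0 b0 kN bK; have C0 : (0 < 'C(N, k))%N by rewrite bin_gt0.
rewrite -[leRHS](powR_mean_const p0 b0 (card_erasures N k) C0).
apply: powR_mean_le; rewrite ?invr_ge0 ?ler0n // => K /eqP Kk.
by rewrite spectral_radius_ge0 bK.
Qed.

(** * Tight frames *)

(** Polarization: a symmetric matrix is determined by its quadratic form. *)
Lemma sym_mx_quad_eq0 (R : numFieldType) (n : nat) (S : 'M[R]_n) :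
  S^T = S -> (forall f : 'cV[R]_n, (f^T *m S *m f) 0 0 = 0) -> S = 0.
Proof.
move=> ST S0.
pose b (f g : 'cV[R]_n) : R := (f^T *m S *m g) 0 0.
have bDl f g h : b (f + g) h = b f h + b g h.
  by rewrite /b [(f + g)^T]raddfD !mulmxDl mxE.
have bDr f g h : b h (f + g) = b h f + b h g by rewrite /b mulmxDr mxE.
have bE i j : b (delta_mx i 0) (delta_mx j 0) = S i j.
  by rewrite /b trmx_delta -rowE -colE !mxE.
have Sd i : S i i = 0 by rewrite -bE; apply: S0.
apply/matrixP => i j; rewrite [RHS]mxE.
have : b (delta_mx i 0 + delta_mx j 0) (delta_mx i 0 + delta_mx j 0) = 0.
  exact: S0.
rewrite !(bDl, bDr) !bE !Sd -[in S j i]ST mxE add0r addr0 => /eqP.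
by rewrite -mulr2n mulrn_eq0 => /eqP.
Qed.

Lemma parseval_tight (R : realType) (N n : nat) (F : 'I_N -> 'cV[R]_n) (a : R)
    (f : 'cV[R]_n) :
  frame_bounds F a a -> a * dotp f f = \sum_i `|dotp f (F i)| ^+ 2.
Proof. by case=> _ _ Fa; apply/eqP; rewrite eq_le. Qed.

Lemma tight_frame_op (R : realType) (N n : nat) (F : 'I_N -> 'cV[R]_n) (a : R) :
  frame_bounds F a a -> frame_op F = a%:M.
Proof.
move=> Fa; apply/eqP; rewrite -subr_eq0; apply/eqP/sym_mx_quad_eq0.
  by rewrite linearB /= trmx_mul trmxK tr_scalar_mx.
move=> f.
rewrite mulmxBr mulmxBl mxE mulmxA mul_mx_scalar -scalemxAl -trmx_mul.
rewrite -mulmxA analysis_mxE !mxE.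
have -> : \sum_j f^T 0 j * f j 0 = dotp f f.
  by apply: eq_bigr => j _; rewrite mxE.
rewrite (parseval_tight f Fa); apply/eqP; rewrite subr_eq0.
apply/eqP/eq_bigr => i _.
by rewrite !mxE real_normK ?num_real.
Qed.

Lemma canonical_dual_tight (R : realType) (N n : nat) (F : 'I_N -> 'cV[R]_n)
    (a : R) (i : 'I_N) :
  frame_bounds F a a -> canonical_dual F i = a^-1 *: F i.
Proof.
move=> Fa; rewrite /canonical_dual (tight_frame_op Fa) invmx_scalar.
by rewrite mul_scalar_mx.
Qed.

Lemma analysis_canonical_dual_tight (R : realType) (N n : nat)
    (F : 'I_N -> 'cV[R]_n) (a : R) :
  frame_bounds F a a ->
  analysis_mx (canonical_dual F) = a^-1 *: analysis_mx F.
Proof.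
by move=> Fa; apply/matrixP => i j; rewrite mxE (canonical_dual_tight i Fa) !mxE.
Qed.

Lemma dotpZr (R : realType) (n : nat) (a : R) (f g : 'cV[R]_n) :
  dotp f (a *: g) = a * dotp f g.
Proof. by rewrite /dotp mulr_sumr; apply: eq_bigr => j _; rewrite mxE mulrCA. Qed.

Lemma dual_pair_canonical_tight (R : realType) (N n : nat)
    (F : 'I_N -> 'cV[R]_n) (a : R) :
  frame_bounds F a a -> dual_pair F (canonical_dual F).
Proof.
move=> Fa; have [a0 _ Fb] := Fa; split; first by exists a, a.
  exists a^-1, a^-1; split; rewrite ?invr_gt0 // => f.
  have -> : \sum_i `|dotp f (canonical_dual F i)| ^+ 2 = a^-1 * dotp f f.
    under eq_bigr do rewrite (canonical_dual_tight _ Fa) dotpZr normrM exprMn.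
    rewrite -mulr_sumr -(parseval_tight f Fa) real_normK ?num_real //.
    by rewrite expr2 -mulrA mulKf ?gt_eqF.
  by rewrite lexx.
move=> f; transitivity ((analysis_mx (canonical_dual F))^T *m analysis_mx F *m f).
  rewrite (analysis_canonical_dual_tight Fa) linearZ /= -scalemxAl.
  rewrite -/(frame_op F) (tight_frame_op Fa) scale_scalar_mx mulVf ?gt_eqF //.
  by rewrite mul1mx.
rewrite -mulmxA analysis_mxE analysis_mx_adjE.
by apply: eq_bigr => i _; rewrite mxE.
Qed.

Lemma conj_map_real_complex (R : realType) (m n : nat) (A : 'M[R]_(m, n)) :
  map_mx Num.conj (map_mx (real_complex R) A) = map_mx (real_complex R) A.
Proof. by apply/matrixP => i j; rewrite !mxE conj_Creal // complex_real. Qed.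

Lemma row_conj_norm (C : numClosedFieldType) (n : nat) (v : 'rV[C]_n) :
  (v *m (map_mx Num.conj v)^T) 0 0 = \sum_j `|v 0 j| ^+ 2.
Proof. by rewrite mxE; apply: eq_bigr => j _; rewrite !mxE normCK. Qed.

(** Let [v] be a left eigenvector for [z], and [u] the image of [v] under the
    analysis operator. Then [z] is the quotient of the sum of the [|u_i| ^ 2] over
    [K] by their sum over all indices. *)
Lemma spectral_radius_tight_le1 (R : realType) (N n : nat)
    (F : 'I_N -> 'cV[R]_n) (a : R) (K : {set 'I_N}) :
  frame_bounds F a a ->
  spectral_radius ((analysis_mx (canonical_dual F))^T *m erasure_mx R K
    *m analysis_mx F) <= 1.
Proof.
move=> Fa; have [a0 _ _] := Fa; have SF := tight_frame_op Fa.
rewrite (analysis_canonical_dual_tight Fa) linearZ /= -!scalemxAl.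
apply: spectral_radius_le => // z /eigenvalueP[v vz v0].
pose toC := real_complex R; pose T := map_mx toC (analysis_mx F).
pose E := map_mx toC (erasure_mx R K).
pose u := v *m map_mx toC (analysis_mx F)^T; pose q := \sum_j `|v 0 j| ^+ 2.
have uT : (map_mx Num.conj u)^T = T *m (map_mx Num.conj v)^T.
  by rewrite map_mxM conj_map_real_complex trmx_mul -map_trmx trmxK.
have aC : toC a^-1 * toC a = 1.
  by rewrite -rmorphM mulVf ?rmorph1 ?gt_eqF.
have q_u : q = toC a^-1 * \sum_i `|u 0 i| ^+ 2.
  rewrite -row_conj_norm uT mulmxA -(mulmxA v) /T -map_mxM.
  rewrite -/(frame_op F) SF map_scalar_mx mul_mx_scalar -scalemxAl mxE.
  by rewrite row_conj_norm mulrA aC mul1r.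
have z_u : z * q = toC a^-1 * \sum_(i in K) `|u 0 i| ^+ 2.
  have : (z *: v *m (map_mx Num.conj v)^T) 0 0 = z * q.
    by rewrite -scalemxAl mxE row_conj_norm.
  rewrite -vz => <-.
  rewrite map_mxZ !map_mxM -/toC -/T -/E -scalemxAr -scalemxAl mxE.
  congr (_ * _); rewrite !mulmxA -/u -(mulmxA _ T) -uT.
  rewrite mxE [RHS]big_mkcond; apply: eq_bigr => i _.
  rewrite /E /erasure_mx map_diag_mx mul_mx_diag !mxE normCK.
  by case: (i \in K); rewrite ?(rmorph1, rmorph0, mulr1, mulr0, mul0r).
have q0 : 0 < q.
  have /rV0Pn[j vj] := v0.
  by rewrite /q (bigD1 j) //= ltr_pwDl ?exprn_gt0 ?normr_gt0 // sumr_ge0.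
have aC0 : 0 <= toC a^-1 by rewrite lecR invr_ge0 ltW.
have sum0 : 0 <= \sum_(i in K) `|u 0 i| ^+ 2.
  by rewrite sumr_ge0.
suff : `|z| <= (1 : R[i]) by [].
rewrite -(ler_pM2r q0) mul1r -[X in _ * X](gtr0_norm q0) -normrM z_u.
rewrite ger0_norm ?mulr_ge0 // q_u ler_wpM2l //.
by rewrite [leRHS](bigID [in K]) /= lerDl sumr_ge0.
Qed.

(** * Laplacian frames *)

Lemma laplacian_row_sum0 (R : realType) (N : nat) (e : rel 'I_N) :
  laplacian R e *m const_mx 1 = 0 :> 'cV[R]_N.
Proof.
apply/colP => i; rewrite mulmxBl mul_diag_mx !mxE mulr1.
rewrite -sum1_card natr_sum big_mkcond; apply/eqP; rewrite subr_eq0; apply/eqP.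
by apply: eq_bigr => j _; rewrite !mxE mulr1 inE; case: (e i j).
Qed.

(** Connectedness enters through the shape of [laplacian_frame] in codimension
    one: a single coefficient of [lam] vanishes, so the constant vectors, which
    lie in the kernel of the Laplacian, are the multiples of the last column of
    [M]. *)
Lemma laplacian_frame_sqnorm (R : realType) (n : nat) (e : rel 'I_n.+1)
    (F : 'I_n.+1 -> 'cV[R]_n) (a : R) (i : 'I_n.+1) :
  laplacian_frame e F -> frame_op F = a%:M ->
  dotp (F i) (F i) = a * (n%:R / n.+1%:R).
Proof.
case=> leq_n [M [lam [_ MMT lam0 LE FE]]] Fa.
pose w (k : 'I_n) : 'I_n.+1 := widen_ord (leqnSn n) k.
pose s k := Num.sqrt (lam 0 (w k)).
have FMs j k : F j k 0 = s k * M j (w k).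
  have wE (l : 'I_n) : widen_ord leq_n l = w l by apply: val_inj.
  by rewrite FE -mulmxA -colE mul_diag_mx !mxE wE.
have MTM : M^T *m M = 1%:M by apply: mulmx1C.
have s2 k : s k ^+ 2 = a.
  have := congr1 (fun B : 'M[R]_n => B k k) Fa; rewrite !mxE eqxx mulr1n => <-.
  have /(congr1 (fun B : 'M[R]_n.+1 => B (w k) (w k))) := MTM.
  rewrite !mxE eqxx mulr1n => MTMk.
  rewrite -[LHS]mulr1 -MTMk mulr_sumr.
  by apply: eq_bigr => j _; rewrite !mxE FMs; ring.
have row_norm j : \sum_(k < n) M j (w k) ^+ 2 + M j ord_max ^+ 2 = 1.
  have /(congr1 (fun B : 'M[R]_n.+1 => B j j)) := MMT.
  rewrite [RHS]mxE eqxx mulr1n mxE big_ord_recr /= mxE -expr2 => <-.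
  by congr (_ + _); apply: eq_bigr => k _; rewrite mxE.
(* The coordinates [c] of the constant vector in the basis of the columns of [M]
   vanish except the last. *)
pose one : 'cV[R]_n.+1 := const_mx 1.
pose c := M^T *m one.
have c0 k : c (w k) 0 = 0.
  have : diag_mx lam *m c = 0.
    rewrite -[LHS]mul1mx -MTM /c -!mulmxA (mulmxA M) (mulmxA (M *m _)) -LE.
    by rewrite laplacian_row_sum0 mulmx0.
  move=> /colP/(_ (w k)); rewrite mul_diag_mx !mxE => /eqP; rewrite mulf_eq0.
  by rewrite (negPf (_ : lam 0 (w k) != 0)) ?lam0 //= => /eqP.
have Mc j : M j ord_max * c ord_max 0 = 1.
  have : (M *m c) j 0 = 1 by rewrite /c mulmxA MMT mul1mx mxE.
  rewrite mxE big_ord_recr /= big1 ?add0r // => k _.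
  by rewrite -/(w k) c0 mulr0.
have Mlast j : M j ord_max ^+ 2 = n.+1%:R^-1.
  have cN0 : c ord_max 0 != 0.
    by apply: contraTneq (oner_neq0 R) => c0'; rewrite -(Mc j) c0' mulr0 eqxx.
  have ME l : M l ord_max = M j ord_max.
    by apply: (mulIf cN0); rewrite !Mc.
  have /(congr1 (fun B : 'M[R]_n.+1 => B ord_max ord_max)) := MTM.
  rewrite !mxE eqxx mulr1n.
  under eq_bigr do rewrite mxE ME -expr2.
  rewrite sumr_const card_ord -[LHS]mulr_natr => MN.
  have n0 : n.+1%:R != 0 :> R by rewrite pnatr_eq0.
  by apply: (mulIf n0); rewrite MN mulVf.
have -> : n%:R / n.+1%:R = 1 - n.+1%:R^-1 :> R.
  by rewrite -[n.+1%:R in RHS]natr1 -[in LHS]natr1; field; rewrite natr1 pnatr_eq0.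
rewrite -(Mlast i) -(row_norm i) addrK mulr_sumr.
by apply: eq_bigr => k _; rewrite FMs -(s2 k); ring.
Qed.

(** * Optimality of the canonical dual *)

Theorem theorem5p2 (R : realType) (p : R) (N : nat) (e : rel 'I_N)
    (F : 'I_N -> 'cV[R]_(N.-1)) :
  1 < p -> (2 <= N)%N ->
  simple_graph e -> connected_graph e ->
  laplacian_frame e F ->
  tight_frame F ->
  optimal2 p (F, canonical_dual F).
Proof.
case: N e F => [//|[//|n]] e F p1 _ _ _ lapF [a Fa]; rewrite /= in F lapF Fa *.
have p0 : 0 < p by apply: lt_trans p1.
have [a0 _ _] := Fa.
have FG := dual_pair_canonical_tight Fa.
set G := canonical_dual F in FG *.
have FGi i : dotp (F i) (G i) = n.+1%:R / n.+2%:R.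
  rewrite /G (canonical_dual_tight i Fa) dotpZr.
  by rewrite (laplacian_frame_sqnorm i lapF (tight_frame_op Fa)) mulKf ?gt_eqF.
have E1 : erasure_error 1 p F G = n.+1%:R / n.+2%:R.
  rewrite erasure_error1E //; under eq_bigr do rewrite FGi.
  rewrite (powR_mean_const p0 (normr_ge0 _) (card_ord _)) //.
  by rewrite ger0_norm ?divr_ge0 ?ler0n.
have E2 : erasure_error 2 p F G <= 1.
  apply: erasure_error_le => // K _; exact: spectral_radius_tight_le1 Fa.
have opt1 : optimal1 p (F, G).
  split=> //=; apply/eqP; rewrite eq_le; apply/andP; split.
    rewrite E1; apply: lb_le_inf; first by exists (erasure_error 1 p F G), (F, G).
    by move=> _ [[F' G'] /= FG' <-]; apply: erasure_error1_ge => //; apply: ltW.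
  apply: ge_inf; last by exists (F, G).
  by exists 0 => _ [FG' _ <-]; apply: powR_ge0.
split=> //=; apply/eqP; rewrite eq_le; apply/andP; split.
  apply: lb_le_inf; first by exists (erasure_error 2 p F G), (F, G).
  move=> _ [[F' G'] /= [FG' _] <-]; apply: le_trans E2 _.
  apply: erasure_error_ge => // K K2.
  by apply: spectral_radius_erasure_ge1; rewrite ?K2.
apply: ge_inf; last by exists (F, G).
by exists 0 => _ [FG' _ <-]; apply: powR_ge0.
Qed.
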